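(* Let $X$ be a separated (Hausdorff) barrelled space and let $Y$ be a fully complete space. Let $\Gamma \subseteq X \times Y$ be a closed linear relation (that is, a linear subspace of $X \times Y$ that is closed in the product topology) with $\mathrm{Dom}\,\Gamma = X$. If $B \subseteq Y$ is open, then $\Gamma\, B \subseteq X$ is open.
   Context: All vector spaces are over the same scalar field, $\mathbb{R}$ or $\mathbb{C}$. A relation from $X$ to $Y$ is a subset $\Gamma \subseteq X \times Y$. For $B \subseteq Y$, write $\Gamma\, B = \{x \in X : \exists\, b \in B,\ (x,b) \in \Gamma\}$; the domain of $\Gamma$ is $\mathrm{Dom}\,\Gamma = \Gamma\, Y = \{x \in X : \exists\, y \in Y,\ (x,y)\in\Gamma\}$. A barrel in a locally convex topological vector space is a closed, absolutely convex, absorbing subset; a barrelled space is a locally convex topological vector space in which every barrel is a neighbourhood of zero. A fully complete space (also called a Ptak space or $B$-complete space) is a separated (Hausdorff) locally convex topological vector space $Y$ with continuous dual $Y'$ such that a linear subspace $M \subseteq Y'$ is weak-* (i.e. $\sigma(Y',Y)$-) closed whenever $M \cap U^\circ$ is $\sigma(Y',Y)$-closed for every neighbourhood $U$ of zero in $Y$, where $U^\circ = \{f \in Y' : |f(u)| \le 1 \text{ for all } u \in U\}$ is the polar of $U$. *)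

(* Defs.v *)
From HB Require Import structures.
From mathcomp Require Export all_boot all_order all_algebra.
From mathcomp Require Export all_classical all_reals all_analysis.
From mathcomp Require Export complex.
Export Order.TTheory GRing.Theory Num.Theory.
Export numFieldNormedType.Exports.

Set Implicit Arguments.
Unset Strict Implicit.
Unset Printing Implicit Defensive.

Local Open Scope classical_set_scope.
Local Open Scope ring_scope.
Local Open Scope complex_scope.

Definition real_or_complex (R : realType) (K : numFieldType) : Prop :=
  K = R \/ K = R[i].

Section relations.
Context (X Y : Type).
Implicit Types (Gamma : set (X * Y)) (B : set Y).

Definition rel_preimage Gamma B : set X :=
  [set x | exists2 b, B b & Gamma (x, b)].

Definition rel_dom Gamma : set X := rel_preimage Gamma [set: Y].

End relations.

Definition linear_subspace (K : numFieldType) (V : lmodType K) (M : set V) :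
  Prop := submod_closed [in M].

Section barrels.
Context (K : numFieldType) (X : tvsType K).
Implicit Type B : set X.

Definition balanced B : Prop :=
  forall (a : K) x, `|a| <= 1 -> B x -> B (a *: x).

Definition absolutely_convex B : Prop := convex_set B /\ balanced B.

(* [0 < r] in [K] forces [r] to be real when [K] is complex. *)
Definition absorbing B : Prop :=
  forall x, exists2 r : K, 0 < r &
    forall a : K, r <= `|a| -> exists2 b, B b & x = a *: b.

Definition barrel B : Prop :=
  [/\ closed B, absolutely_convex B & absorbing B].

Definition barrelled_space : Prop := forall B, barrel B -> nbhs (0 : X) B.

End barrels.
Arguments barrelled_space {K} X.

Section fully_complete.
Context (K : numFieldType) (Y : tvsType K).

(* The continuous dual is a subset of the space of all functions [Y -> K]
   with its topology of pointwise convergence; the topology that it inherits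
   from there is sigma(Y', Y). *)
Definition continuous_dual : set {ptws Y -> K^o} :=
  [set f | linear (f : Y -> K^o) /\ continuous (f : Y -> K^o)].

Definition polar (U : set Y) : set {ptws Y -> K^o} :=
  [set f | continuous_dual f /\ forall u, U u -> `|f u : K| <= 1].

(* Meant for [M `<=` continuous_dual]. *)
Definition weak_star_closed (M : set {ptws Y -> K^o}) : Prop :=
  closed (M : set (subspace continuous_dual)).

Definition fully_complete : Prop :=
  hausdorff_space Y /\
  forall M : set {ptws Y -> K^o},
    M `<=` continuous_dual -> linear_subspace (M : set (Y -> K^o)) ->
    (forall U : set Y, nbhs 0 U -> weak_star_closed (M `&` polar U)) ->
    weak_star_closed M.

End fully_complete.
Arguments continuous_dual {K} Y.
Arguments fully_complete {K} Y.

(* Main.v *)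
Require Import Defs.
From mathcomp Require Import ring lra.

(** Fix an absolutely convex neighbourhood [D] of [0] in [Y].  As [Gamma] has
    full domain, [Gamma D] is absorbing, so its closure is a barrel: [Gamma] is
    nearly open ([nearly_open]).  Getting rid of the closure is the role of
    full completeness.

    Let [N := rel_kernel Gamma] be the fibre of [Gamma] above [0], and let
    [M := transpose_dom Gamma] consist of the continuous forms [f] on [Y] for
    which [x |-> f y], with [(x, y)] in [Gamma], is a well-defined continuous
    form [g] on [X].  Every [f] in [M] vanishes on [N].  The point is that,
    conversely, every continuous form vanishing on [N] is in [M]
    ([transpose_dom_full]); this takes three facts.
    - The trace of [M] on the polar of a neighbourhood [U] is again a polar,
      hence weak-* closed: being bounded by [1] on the fibres above the closure
      of [Gamma U] forces [g] to exist and to be continuous, since that closure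
      is a neighbourhood of [0] ([transpose_dom_polar]).  By full completeness
      [M] is weak-* closed.
    - [Gamma] being closed, Hahn-Banach separation in [X * Y] shows that a point
      annihilated by [M] is in [N] ([transpose_dom_separates]).
    - A weak-* closed subspace contains every continuous form that vanishes
      wherever all its elements do ([weak_star_closed_bipolar]).

    Now let [x] be in half the closure of [Gamma D] and let [(x, y)] be in
    [Gamma].  If [y] were not in [D + N], Hahn-Banach would give [f], bounded by
    [1] on [D], zero on [N], with [|f y| >= 1]; but the associated [g] is
    continuous and bounded by [1] on [Gamma D], so [|f y| = |g x| <= 1 / 2].
    Hence [y] is in [D + N], that is, [x] is in [Gamma D] ([rel_preimage_nbhs0]).

    Hahn-Banach itself is obtained from Zorn's lemma applied to sublinear
    functionals rather than to partial linear forms: a minimal sublinear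
    functional is linear. *)

Set Implicit Arguments.
Unset Strict Implicit.
Unset Printing Implicit Defensive.

Local Open Scope classical_set_scope.
Local Open Scope ring_scope.

(** * Sublinear functionals and the Hahn-Banach theorem over the reals *)

Section sublinear.
Context (R : realType) (K : numFieldType) (iota : {rmorphism R -> K}).
Context (V : lmodType K).
(* [V] is used as a real vector space through [iota], so that real and complex
   scalars are treated together. *)
Implicit Types (p q f : V -> R) (x y : V).

Definition sublinear q : Prop :=
  (forall x y, q (x + y) <= q x + q y) /\
  (forall (t : R) x, 0 < t -> q (iota t *: x) <= t * q x).

Lemma sublinear0 q : sublinear q -> q 0 = 0.
Proof.
move=> [qD qZ]; have := qD 0 0; have := qZ 2^-1 0.
by rewrite scaler0 addr0 invr_gt0 ltr0n => /(_ isT); lra.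
Qed.

Lemma sublinearN q x : sublinear q -> - q (- x) <= q x.
Proof.
move=> sq; have := sq.1 x (- x); rewrite subrr sublinear0 //; lra.
Qed.

Lemma sublinearZ q (t : R) x :
  sublinear q -> 0 <= t -> q (iota t *: x) = t * q x.
Proof.
move=> sq; rewrite le0r => /orP[/eqP ->|t0].
  by rewrite rmorph0 scale0r mul0r sublinear0.
apply/eqP; rewrite eq_le sq.2 //=.
have := sq.2 t^-1 (iota t *: x); rewrite invr_gt0 => /(_ t0).
by rewrite scalerA -rmorphM mulVf ?gt_eqF // rmorph1 scale1r ler_pdivlMl.
Qed.

(** All functionals built below are pointwise infima, of families that are
    stable enough under sums and positive dilations for sublinearity to pass to
    the infimum. *)
Lemma sublinear_inf (S : V -> set R) :
    (forall x, has_inf (S x)) ->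
    (forall x y a b, S x a -> S y b -> exists2 c, S (x + y) c & c <= a + b) ->
    (forall (t : R) x a, 0 < t -> S x a ->
       exists2 c, S (iota t *: x) c & c <= t * a) ->
  sublinear (fun x => inf (S x)).
Proof.
move=> infS SD SZ; split=> [x y|t x t0].
  apply/ler_addgt0Pr => e e0; have e20 : 0 < e / 2 by rewrite divr_gt0.
  have [a Sa lta] := inf_adherent e20 (infS x).
  have [b Sb ltb] := inf_adherent e20 (infS y).
  have [c Sc lec] := SD _ _ _ _ Sa Sb.
  have := ge_inf (infS (x + y)).2 Sc; lra.
rewrite -ler_pdivrMl //; apply: lb_le_inf; first exact: (infS x).1.
move=> a /(SZ _ _ _ t0)[c Sc lec]; rewrite ler_pdivrMl //.
exact: le_trans (ge_inf (infS _).2 Sc) lec.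
Qed.

(** A sublinear functional below [q] whose value at [- y] is at most [- q y]:
    the device that turns minimality into additivity. *)
Definition slide q y x : R :=
  inf [set q (x + iota t *: y) - t * q y | t in [set t | 0 <= t]].

Lemma slide_has_inf q y x : sublinear q ->
  has_inf [set q (x + iota t *: y) - t * q y | t in [set t | 0 <= t]].
Proof.
move=> sq; split; first by exists (q (x + iota 0 *: y) - 0 * q y); exists 0 => /=.
exists (- q (- x)) => _ [t /= t0 <-].
have := sq.1 (x + iota t *: y) (- x).
rewrite addrAC subrr add0r sublinearZ //; lra.
Qed.

Lemma slide_le q y x t : sublinear q -> 0 <= t ->
  slide q y x <= q (x + iota t *: y) - t * q y.
Proof.
by move=> sq t0; apply: ge_inf; [exact: (slide_has_inf y x sq).2|exists t].
Qed.

Lemma sublinear_slide q y : sublinear q -> sublinear (slide q y).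
Proof.
move=> sq; apply: sublinear_inf => [x|x z _ _ [s /= s0 <-] [t /= t0 <-]|].
- exact: slide_has_inf.
- exists (q (x + z + iota (s + t) *: y) - (s + t) * q y).
    by exists (s + t) => //=; rewrite addr_ge0.
  have := sq.1 (x + iota s *: y) (z + iota t *: y).
  by rewrite addrACA -scalerDl -rmorphD; lra.
- move=> t x _ t0 [s /= s0 <-].
  exists (q (iota t *: x + iota (t * s) *: y) - t * s * q y).
    by exists (t * s) => //=; rewrite mulr_ge0 // ltW.
  have := sq.2 t (x + iota s *: y) t0.
  by rewrite scalerDr scalerA -rmorphM; lra.
Qed.

Lemma slide_le_id q y x : sublinear q -> slide q y x <= q x.
Proof.
move=> sq; have := slide_le y x sq (lexx 0).
by rewrite rmorph0 scale0r addr0 mul0r subr0.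
Qed.

(** Zorn's lemma; the infimum of a chain is finite because [- p (- x)] is a
    lower bound at [x] for every sublinear functional below [p]. *)
Lemma sublinear_minimal p : sublinear p ->
  exists q, [/\ sublinear q, forall x, q x <= p x &
    forall q', sublinear q' -> (forall x, q' x <= q x) ->
      forall x, q x <= q' x].
Proof.
move=> sp; pose T := {q | sublinear q /\ forall x, q x <= p x}.
pose t0 : T := exist _ p (conj sp (fun x => lexx (p x))).
pose below (q r : T) := `[< forall x, sval r x <= sval q x >].
have [|s r t /asboolP rs /asboolP st||[q [sq qp]] qmin] :=
  @ZL_preorder T t0 below.
- by move=> q; apply/asboolP.
- by apply/asboolP => x; exact: le_trans (st x) (rs x).
- move=> A totA; have [[q0 Aq0]|A0] := pselect (exists q : T, A q); last first.
    by exists t0 => q Aq; case: A0; exists q.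
  pose S x := [set sval q x | q in A].
  have infS x : has_inf (S x).
    split; first by exists (sval q0 x); exists q0.
    exists (- p (- x)) => _ [[q [sq qp]] Aq <-] /=.
    by apply: le_trans (sublinearN x sq); rewrite lerN2.
  have sS : sublinear (fun x => inf (S x)).
    apply: sublinear_inf => // [x y _ _ [q Aq <-] [r Ar <-]|].
      have [/asboolP qr|/asboolP qr] := totA _ _ Aq Ar.
        exists (sval r (x + y)); first by exists r.
        by apply: le_trans ((svalP r).1.1 _ _) _; rewrite lerD2r.
      exists (sval q (x + y)); first by exists q.
      by apply: le_trans ((svalP q).1.1 _ _) _; rewrite lerD2l.
    move=> t x _ lt0t [q Aq <-]; exists (sval q (iota t *: x)).
      by exists q.
    exact: (svalP q).1.2.
  have lS (q : T) x : A q -> inf (S x) <= sval q x.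
    by move=> Aq; apply: ge_inf; [exact: (infS x).2|exists q].
  have Sp x : inf (S x) <= p x.
    exact: le_trans (lS _ _ Aq0) ((svalP q0).2 x).
  pose i : T := exist _ (fun x => inf (S x)) (conj sS Sp).
  by exists i => q Aq; apply/asboolP => x; exact: lS.
exists q; split=> // q' sq' q'q x.
have q'p y : q' y <= p y by exact: le_trans (q'q y) (qp y).
have /(_ (exist _ q' (conj sq' q'p))) := qmin.
by move=> /(_ (introT (asboolP _) q'q)) /asboolP /(_ x).
Qed.

(** Take [f] minimal below [slide p z].  Minimality gives [f <= slide f y],
    whence [f x + f y <= f (x + y)] and [f] is linear; and
    [f (- z) <= slide p z (- z) <= - p z]. *)
Lemma hahn_banach_sublinear p z : sublinear p ->
  exists f, [/\ {morph f : x y / x + y},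
    forall t x, f (iota t *: x) = t * f x,
    forall x, f x <= p x & p z <= f z].
Proof.
move=> sp; have [f [sf lef minf]] := sublinear_minimal (sublinear_slide z sp).
have fD : {morph f : x y / x + y}.
  move=> x y; apply/eqP; rewrite eq_le sf.1 /=.
  have := minf _ (sublinear_slide y sf) (fun u => slide_le_id y u sf) x.
  (* the parameter [t = 1] in the infimum defining [slide] *)
  have := slide_le y x sf (ler01 : 0 <= 1 :> R).
  by rewrite rmorph1 scale1r mul1r; lra.
have fN x : f (- x) = - f x.
  by have := fD x (- x); rewrite subrr sublinear0 //; lra.
exists f; split=> // [t x|x|].
- have [t0|t0] := leP 0 t; first exact: sublinearZ.
  rewrite -[t]opprK rmorphN scaleNr fN sublinearZ ?mulNr //.
  by rewrite oppr_ge0 ltW.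
- exact: le_trans (lef x) (slide_le_id z x sp).
- have := lef (- z); have := slide_le z (- z) sp (ler01 : 0 <= 1 :> R).
  rewrite rmorph1 scale1r addNr sublinear0 // mul1r fN; lra.
Qed.

(** The gauge of [D] is sublinear, at most [1] on [D] and at least [1] off
    [D]. *)
Lemma hahn_banach_gauge (D : set V) z :
    D 0 ->
    (forall (a b : R) x y, 0 <= a -> 0 <= b -> a + b <= 1 ->
      D x -> D y -> D (iota a *: x + iota b *: y)) ->
    (forall x, exists2 r : R, 0 < r & D (iota r *: x)) ->
    ~ D z ->
  exists f, [/\ {morph f : x y / x + y},
    forall t x, f (iota t *: x) = t * f x,
    forall x, D x -> f x <= 1 & 1 <= f z].
Proof.
move=> D0 cD aD nDz.
pose S x := [set r : R | 0 < r /\ D (iota r^-1 *: x)].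
have infS x : has_inf (S x).
  split; last by exists 0 => r [/ltW].
  by have [r r0 Dr] := aD x; exists r^-1; split; rewrite ?invr_gt0 ?invrK.
have sS : sublinear (fun x => inf (S x)).
  apply: sublinear_inf => // [x y r s [r0 Dr] [s0 Ds]|t x r t0 [r0 Dr]].
    exists (r + s) => //; split; first exact: addr_gt0.
    have rs0 : 0 < r + s by exact: addr_gt0.
    have -> : iota (r + s)^-1 *: (x + y) =
        iota (r / (r + s)) *: (iota r^-1 *: x) +
        iota (s / (r + s)) *: (iota s^-1 *: y).
      rewrite !scalerA -!rmorphM scalerDr.
      have e t : 0 < t -> t / (r + s) * t^-1 = (r + s)^-1.
        by move=> t0; rewrite mulrAC mulfV ?mul1r ?gt_eqF.
      by rewrite !e.
    apply: cD => //; first by rewrite divr_ge0 // ltW.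
      by rewrite divr_ge0 // ltW.
    by rewrite -mulrDl mulfV ?gt_eqF.
  exists (t * r) => //; split; first exact: mulr_gt0.
  by rewrite scalerA -rmorphM invfM mulrAC mulVf ?mul1r ?gt_eqF.
have [f [fD fZ fS Sf]] := hahn_banach_sublinear z sS.
exists f; split=> // [x Dx|].
  apply: le_trans (fS x) _; apply: ge_inf; first exact: (infS x).2.
  by split=> //; rewrite invr1 rmorph1 scale1r.
apply: le_trans Sf; apply: lb_le_inf; first exact: (infS z).1.
move=> r [r0 Dr]; rewrite leNgt; apply/negP => r1; apply: nDz.
have := cD r 0 _ 0 (ltW r0) (lexx 0) _ Dr D0.
rewrite addr0 scaler0 addr0 scalerA -rmorphM mulfV ?gt_eqF // rmorph1 scale1r.
by apply; exact: ltW.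
Qed.

End sublinear.

(** * Separation from an absolutely convex set *)

Section abs_convex.
Context (K : numFieldType) (V : lmodType K).
Implicit Types D S : set V.

(** Convexity and balancedness in a single closure property; [0] is required so
    that the set is not empty. *)
Definition abs_convex D : Prop := D 0 /\
  forall (a b : K) x y, `|a| + `|b| <= 1 -> D x -> D y -> D (a *: x + b *: y).

(** For an absolutely convex set this weak form is equivalent to absorption. *)
Definition absorbs D : Prop := forall x, exists2 r : K, 0 < r & D (r *: x).

Lemma abs_convexZ D (a : K) x : abs_convex D -> `|a| <= 1 -> D x -> D (a *: x).
Proof.
move=> [D0 cD] a1 Dx; have := cD a 0 x 0.
by rewrite scaler0 addr0 normr0 addr0; exact.
Qed.

End abs_convex.

Lemma hahn_banach_real (R : realType) (V : lmodType R) (D : set V) z :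
  abs_convex D -> absorbs D -> ~ D z ->
  exists f : V -> R^o,
    [/\ linear f, forall x, D x -> `|f x| <= 1 & 1 <= `|f z|].
Proof.
move=> cD aD nDz.
have [|f [fD fZ f1 fz]] := @hahn_banach_gauge R R idfun V D z cD.1 _ aD nDz.
  by move=> a b x y a0 b0 ab Dx Dy; apply: cD.2; rewrite // !ger0_norm.
exists f; split=> [a x y|x Dx|]; first by rewrite fD fZ.
  have /f1 : D (-1 *: x) by apply: abs_convexZ; rewrite // normrN1.
  by rewrite (fZ (-1)) ler_norml (f1 _ Dx); lra.
exact: le_trans fz (ler_norm _).
Qed.

Section complex_hahn_banach.
Context (R : realType).
Local Open Scope complex_scope.

(** A real-linear [u] is the real part of [f x = u x - i u (i x)], which is
    complex linear. *)
Lemma hahn_banach_complex (V : lmodType R[i]) (D : set V) z :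
  abs_convex D -> absorbs D -> ~ D z ->
  exists f : V -> R[i]^o,
    [/\ linear f, forall x, D x -> `|f x| <= 1 & 1 <= `|f z|].
Proof.
move=> cD aD nDz.
have [||u [uD uZ u1 uz]] :=
    @hahn_banach_gauge R R[i] (real_complex R) V D z cD.1 _ _ nDz.
- move=> a b x y a0 b0 ab Dx Dy; apply: cD.2 => //.
  by rewrite !ger0_norm ?ler0c // -rmorphD lecR.
- move=> x; have [r r0 Dr] := aD x.
  exists (complex.Re r); case: r r0 Dr => a b;
    by rewrite ltcE /= => /andP[/eqP ->].
pose f x : R[i]^o := u x -i* u ('i *: x).
have fD : {morph f : x y / x + y}.
  by move=> x y; rewrite /f scalerDr !uD opprD.
have uN x : u (- x) = - u x.
  by have := uZ (-1) x; rewrite rmorphN1 scaleN1r mulN1r.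
have fZ a x : f (a *: x) = a *: f x.
  have uI y : u ('i *: ('i *: y)) = - u y.
    by rewrite scalerA -expr2 sqr_i scaleN1r uN.
  case: a => a b; rewrite /f.
  have uab y : u ((a +i* b) *: y) = a * u y + b * u ('i *: y).
    have -> : a +i* b = real_complex R a + real_complex R b * 'i.
      by rewrite [LHS]complexE /= [_ * 'i]mulrC.
    by rewrite scalerDl uD -scalerA !uZ.
  rewrite scalerA ['i * _]mulrC -scalerA !uab uI.
  by apply/eqP; rewrite eq_complex /=; apply/andP; split; apply/eqP; ring.
have fRe x : complex.Re (f x) = u x by [].
exists f; split=> [a x y|x Dx|]; first by rewrite fD fZ.
  have [->|fx0] := eqVneq (f x) 0; first by rewrite normr0.
  (* the phase [c] makes [f (c *: x)] real, hence equal to [u (c *: x)] *)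
  pose c := `|f x| / f x.
  have fc : f (c *: x) = `|f x| by rewrite fZ /c /GRing.scale /= divfK.
  have Dc : D (c *: x).
    by apply: abs_convexZ => //; rewrite normf_div normr_id divff // normr_eq0.
  have := u1 _ Dc; rewrite -fRe fc.
  by rewrite -lecR RRe_real // normr_real.
apply: le_trans (normc_ge_Re (f z)).
by rewrite fRe -(rmorph1 (real_complex R)) lecR (le_trans uz) ?ler_norm.
Qed.

End complex_hahn_banach.

(** The Hahn-Banach theorem in its geometric form. *)
Lemma hahn_banach (R : realType) (K : numFieldType) (hK : real_or_complex R K)
    (V : lmodType K) (D : set V) z :
  abs_convex D -> absorbs D -> ~ D z ->
  exists f : V -> K^o,
    [/\ linear f, forall x, D x -> `|f x| <= 1 & 1 <= `|f z|].
Proof.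
case: hK V D z => ->.
- exact: hahn_banach_real.
- exact: hahn_banach_complex.
Qed.

(** * Linear subspaces and linear forms *)

Section subspaces.
Context (K : numFieldType) (V : lmodType K).
Implicit Types M S D : set V.

Lemma linear_subspaceP M : linear_subspace M <->
  M 0 /\ forall (a : K) x y, M x -> M y -> M (a *: x + y).
Proof.
split=> [[M0 MD]|[M0 MD]].
  split=> [|a x y Mx My]; first by rewrite inE in M0.
  by have := MD a x y; rewrite !inE; apply.
by split=> [|a x y]; rewrite !inE //; exact: MD.
Qed.

Lemma linear_subspaceZ M (a : K) x : linear_subspace M -> M x -> M (a *: x).
Proof.
move=> /linear_subspaceP[M0 MD] Mx.
by rewrite -[_ *: _]addr0; exact: MD.
Qed.

Lemma linear_subspaceB M x y : linear_subspace M -> M x -> M y -> M (x - y).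
Proof.
move=> /linear_subspaceP[M0 MD] Mx My.
by rewrite addrC -scaleN1r; exact: MD.
Qed.

Definition sum_set D S : set V := [set x | exists2 s, S s & D (x - s)].

Lemma sum_set_subl D S : linear_subspace S -> D `<=` sum_set D S.
Proof.
by move=> /linear_subspaceP[S0 _] x Dx; exists 0; rewrite ?subr0.
Qed.

Lemma abs_convex_sum_set D S :
  abs_convex D -> linear_subspace S -> abs_convex (sum_set D S).
Proof.
move=> cD lS; split; first exact: (sum_set_subl lS cD.1).
move=> a b x y ab [s Ss Ds] [t St Dt]; exists (a *: s + b *: t).
  have [_ SD] := (linear_subspaceP S).1 lS.
  by apply: SD => //; exact: linear_subspaceZ.
by rewrite opprD addrACA -!scalerBr; exact: cD.2.
Qed.

Lemma linear_form0 (f : V -> K^o) : linear f -> f 0 = 0.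
Proof.
by move=> lf; have := lf (-1) 0 0; rewrite scaleN1r addNr scaleN1r addNr.
Qed.

Lemma linear_formZ (f : V -> K^o) (a : K) x : linear f -> f (a *: x) = a * f x.
Proof.
by move=> lf; have := lf a x 0; rewrite addr0 linear_form0 // addr0.
Qed.

Lemma linear_formB (f : V -> K^o) x y : linear f -> f (x - y) = f x - f y.
Proof.
by move=> lf; rewrite addrC -scaleN1r lf scaleN1r addrC.
Qed.

(** A linear form that is bounded on the line through [x] is zero at [x]. *)
Lemma linear_bounded_subspace (f : V -> K^o) M x : linear f ->
  linear_subspace M -> (forall x, M x -> `|f x| <= 1) -> M x -> f x = 0.
Proof.
move=> lf lM fM Mx; apply/eqP/negP => /negP fx0.
have := fM _ (linear_subspaceZ (2 / f x) lM Mx).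
by rewrite linear_formZ // divfK // ger0_norm // (ler_nat K 2 1).
Qed.

End subspaces.

(** * Locally convex spaces and barrels *)

Section tvs.
Context (K : numFieldType) (E : tvsType K).
Implicit Types U D S : set E.

Lemma scaler_continuous (a : K) : continuous (fun x : E => a *: x).
Proof.
move=> x.
apply: (@continuous_comp E (K^o * E)%type E (fun x => (a, x))
  (fun z => z.1 *: z.2)); last exact: scale_continuous.
by apply: (@cvg_pair _ _ _ _ (nbhs (a : K^o))); [exact: cvg_cst|exact: cvg_id].
Qed.

(** To get [a *: x + b *: y] from convexity, move the phases of [a] and [b] into
    [x] and [y], take the convex combination with weights proportional to [|a|]
    and [|b|], and scale it by [|a| + |b| <= 1]. *)
Lemma absolutely_convexE D :
  D 0 -> absolutely_convex D <-> abs_convex D.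
Proof.
move=> D0; split=> [[cD bD]|cD]; last first.
  split; last by move=> a x a1; exact: abs_convexZ.
  move=> x y l; rewrite !inE => Dx Dy; apply: cD.2 => //.
  by rewrite !ger0_norm ?unstable.onem_ge0 // unstable.add_onemK.
split=> // a b x y ab Dx Dy.
have normE (c : K) : exists2 u : K, `|u| <= 1 & c = `|c| * u.
  have [->|c0] := eqVneq c 0; first by exists 0; rewrite ?mulr0 ?normr0.
  exists (c / `|c|); last by rewrite mulrC divfK ?normr_eq0.
  by rewrite normf_div normr_id divff ?normr_eq0.
have [u u1 aE] := normE a; have [v v1 bE] := normE b.
set s := `|a| + `|b| in ab.
have s0 : 0 <= s by rewrite addr_ge0.
have [s_eq0|s_neq0] := eqVneq s 0.
  have /andP[/eqP a0 /eqP b0] : (`|a| == 0) && (`|b| == 0).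
    by rewrite -paddr_eq0 //; apply/eqP.
  by rewrite aE bE a0 b0 !mul0r !scale0r addr0.
have l0 : 0 <= `|a| / s by rewrite divr_ge0.
have l1 : `|a| / s <= 1.
  by rewrite ler_pdivrMr ?lt0r ?s_neq0 // mul1r lerDl.
have := cD (u *: x) (v *: y) (Itv01 l0 l1).
rewrite !inE => /(_ (bD _ _ u1 Dx) (bD _ _ v1 Dy)) Dc.
have := bD s _ _ Dc; rewrite ger0_norm // => /(_ ab).
rewrite /conv /= /unstable.onem.
have -> : 1 - `|a| / s = `|b| / s.
  by rewrite -[1](divff s_neq0) -mulrBl /s addrAC subrr add0r.
have sK c : s * (c / s) = c by rewrite mulrC divfK.
by rewrite scalerDr ![s *: (_ *: _)]scalerA !sK !scalerA -aE -bE.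
Qed.

Lemma nbhs0_absorbs U : nbhs 0 U -> absorbs U.
Proof.
move=> U0 x; have := @scale_continuous K E (0 : K^o, x) U.
rewrite /= scale0r => /(_ U0)[[A B] /= [A0 Bx] ABU].
have /nbhs_ballP[e /= e0 eA] := A0.
exists (e / 2); first by rewrite divr_gt0.
apply: (ABU (e / 2, x)); split; last exact: nbhs_singleton.
apply: eA; rewrite -ball_normE /= sub0r normrN ger0_norm ?divr_ge0 ?ltW //.
by rewrite ltr_pdivrMr // ltr_pMr // ltr1n.
Qed.

(** The largest balanced subset of a convex neighbourhood of [0] is convex, and is
    still a neighbourhood by continuity of the scaling at [(0, 0)]. *)
Lemma nbhs0_abs_convex U : nbhs 0 U ->
  exists D, [/\ nbhs 0 D, abs_convex D & D `<=` U].
Proof.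
move=> U0; have [B cB [oB bB]] := @locally_convex K E.
have [C [BC C0] CU] := bB 0 U U0.
have nC : nbhs 0 C by apply: open_nbhs_nbhs; split=> //; exact: oB.
pose D := [set x | forall a : K, `|a| <= 1 -> C (a *: x)].
have D0 : D 0 by move=> a _; rewrite scaler0.
exists D; split; last by move=> x /(_ 1); rewrite normr1 scale1r => /(_ (lexx 1)) /CU.
  have := @scale_continuous K E (0 : K^o, 0) C; rewrite /= scaler0.
  move=> /(_ nC)[[A N] /= [A0 N0] ANC].
  have /nbhs_ballP[e /= e0 eA] := A0.
  have e20 : 0 < e / 2 by rewrite divr_gt0.
  apply: filterS (nbhs0Z (lt0r_neq0 e20) N0) => _ [x Nx <-] a a1.
  rewrite scalerA; apply: (ANC (a * (e / 2), x)); split=> //=.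
  apply: eA; rewrite -ball_normE /= sub0r normrN normrM.
  rewrite [`|e / 2|]gtr0_norm //; apply: le_lt_trans (_ : e / 2 < e).
    by rewrite ler_piMl // ltW.
  by rewrite ltr_pdivrMr // ltr_pMr // ltr1n.
apply/absolutely_convexE => //; split.
  move=> x y l; rewrite !inE => Dx Dy a a1.
  have := cB _ (mem_set BC) (a *: x) (a *: y) l.
  rewrite !inE => /(_ (Dx _ a1) (Dy _ a1)).
  by rewrite /conv /= scalerDr !scalerA ![_ * a]mulrC.
move=> b x b1 Dx a a1; rewrite scalerA; apply: Dx.
by rewrite normrM mulr_ile1.
Qed.

Lemma abs_convex_closure D : abs_convex D -> abs_convex (closure D).
Proof.
move=> cD; split; first exact: subset_closure cD.1.
move=> a b x y ab clx cly W.
move=> /(@add_continuous E (a *: x, b *: y))[[A B] /= [Ax By] ABW].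
have [x' [Dx' Ax']] := clx _ (scaler_continuous Ax).
have [y' [Dy' By']] := cly _ (scaler_continuous By).
exists (a *: x' + b *: y'); split; first exact: cD.2.
exact: (ABW (a *: x', b *: y')).
Qed.

Lemma barrelled_closure D : barrelled_space E ->
  abs_convex D -> absorbs D -> nbhs 0 (closure D).
Proof.
move=> barE cD aD; apply: barE; have cclD := abs_convex_closure cD.
split; first exact: closed_closure.
  by apply/absolutely_convexE => //; exact: cclD.1.
move=> x; have [r r0 Dr] := aD x; exists r^-1; first by rewrite invr_gt0.
move=> a ra; have a0 : a != 0.
  by rewrite -normr_gt0 (lt_le_trans _ ra) ?invr_gt0.
exists (a^-1 *: x); last by rewrite scalerA divff // scale1r.
apply: subset_closure.
have -> : a^-1 *: x = (a^-1 / r) *: (r *: x).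
  by rewrite scalerA divfK // gt_eqF.
apply: abs_convexZ => //; rewrite normrM !normfV (ger0_norm (ltW r0)).
by rewrite mulrC ler_pdivrMr ?normr_gt0 // mul1r.
Qed.

Lemma closed_unit_disk : closed [set k : K^o | `|k : K| <= 1].
Proof.
move=> k clk; apply/ler_addgt0Pr => e e0.
have [c [/= c1]] := clk _ (nbhsx_ballx k e e0).
rewrite -ball_normE /= => kc.
by rewrite -(subrK c k) addrC (le_trans (ler_normD _ _)) // lerD // ltW.
Qed.

Lemma continuous_bounded_closure (f : E -> K^o) D : continuous f ->
  (forall x, D x -> `|f x : K| <= 1) -> forall x, closure D x -> `|f x : K| <= 1.
Proof.
move=> /continuous_closedP /(_ _ closed_unit_disk) clf fD.
move=> x; have /closure_subset := fD : D `<=` f @^-1` [set k | `|k : K| <= 1].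
by rewrite -((closure_id _).1 clf); exact.
Qed.

Lemma linear_bounded_continuous (f : E -> K^o) U : linear f ->
  nbhs 0 U -> (forall x, U x -> `|f x : K| <= 1) -> continuous f.
Proof.
move=> lf U0 fU x; apply/cvgrPdist_lt => e e0.
have e20 : 0 < e / 2 by rewrite divr_gt0.
apply: filterS (nbhsT x (nbhs0Z (lt0r_neq0 e20) U0)) => _ [_ [u Uu <-] <-].
rewrite -linear_formB // opprD addrA subrr sub0r -scaleN1r.
have fZ a y : f (a *: y) = a * f y by exact: linear_formZ.
rewrite !fZ mulN1r normrN normrM gtr0_norm //.
apply: le_lt_trans (_ : e / 2 < e).
  by rewrite ler_piMr ?fU // ltW.
by rewrite ltr_pdivrMr // ltr_pMr // ltr1n.
Qed.

(** Hahn-Banach for [D + S]: boundedness on [D] gives continuity, boundedness on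
    the subspace [S] gives vanishing. *)
Lemma separate_from_subspace (R : realType) (hK : real_or_complex R K) D S z :
  nbhs 0 D -> abs_convex D -> linear_subspace S -> ~ sum_set D S z ->
  exists f : E -> K^o, [/\ linear f, continuous f,
    forall s, S s -> f s = 0, forall x, D x -> `|f x : K| <= 1 & 1 <= `|f z : K|].
Proof.
move=> D0 cD lS nDSz; have DDS := sum_set_subl lS (D := D).
have aDS : absorbs (sum_set D S).
  by move=> x; have [r r0 Dr] := nbhs0_absorbs D0 x; exists r => //; exact: DDS.
have [f [lf fDS fz]] := hahn_banach hK (abs_convex_sum_set cD lS) aDS nDSz.
have fD x : D x -> `|f x : K| <= 1 by move=> /DDS; exact: fDS.
exists f; split=> //; first exact: linear_bounded_continuous fD.
move=> s; apply: linear_bounded_subspace => // t St; apply: fDS.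
by exists t; rewrite ?subrr //; exact: cD.1.
Qed.

End tvs.

(** * Subspaces of the dual in the weak-* topology *)

Section weak_star.
Context (K : numFieldType) (Y : tvsType K).
Implicit Types (M : set (Y -> K^o)) (f m : Y -> K^o) (S : set Y).

(** Induction on the points, with [M] and [f] varying.  If some [m1] in [M] has
    value [1] at the first point [y], the remaining points are treated with the
    forms of [M] vanishing at [y] and with [f - f y *: m1]: a point [z] killed by
    the former makes [z - m1 z *: y] killed by [M]. *)
Lemma linear_subspace_interpolate (ys : seq Y) M f :
    linear_subspace M -> (forall m, M m -> linear m) -> linear f ->
    (forall y, (forall m, M m -> m y = 0) -> f y = 0) ->
  exists2 m, M m & forall y, y \in ys -> m y = f y.
Proof.
elim: ys M f => [|y ys IH] M f lM linM lf Mf.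
  by exists 0 => //; exact: ((linear_subspaceP M).1 lM).1.
have [M0 MD] := (linear_subspaceP M).1 lM.
have [My|] := pselect (forall m, M m -> m y = 0).
  have [m Mm mf] := IH M f lM linM lf Mf; exists m => // z.
  by rewrite in_cons => /orP[/eqP ->|/mf //]; rewrite My // Mf.
move=> /existsNP[m0 /not_implyP[Mm0 /eqP m0y]].
pose m1 := (m0 y)^-1 *: m0.
have Mm1 : M m1 by exact: linear_subspaceZ.
have m1y : m1 y = 1 by exact: mulVf.
pose N := [set m | M m /\ m y = 0].
pose g := f - f y *: m1.
have gE z : g z = f z - f y * m1 z by [].
have lg : linear g.
  by move=> a u v; rewrite !gE lf (linM _ Mm1) /GRing.scale /=; ring.
have [||||m [Mm my] mg] := IH N g.
- apply/linear_subspaceP; split=> // a u v [Mu uy] [Mv vy].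
  split; first exact: MD.
  have -> : (a *: u + v) y = a * u y + v y by [].
  by rewrite uy vy mulr0 addr0.
- by move=> m [/linM].
- exact: lg.
- move=> z Nz; rewrite gE.
  have lz : f (z - m1 z *: y) = 0.
    apply: Mf => m Mm; have lm := linM _ Mm.
    have : N (m - m y *: m1).
      split; first by apply: linear_subspaceB => //; exact: linear_subspaceZ.
      by have -> : (m - m y *: m1) y = m y - m y * m1 y by []; rewrite m1y mulr1 subrr.
    move=> /Nz; have -> : (m - m y *: m1) z = m z - m y * m1 z by [].
    by rewrite (linear_formB _ _ lm) (linear_formZ _ _ lm) mulrC.
  by rewrite (linear_formB _ _ lf) (linear_formZ _ _ lf) mulrC in lz.
exists (f y *: m1 + m); first exact: MD.
move=> z; have -> : (f y *: m1 + m) z = f y * m1 z + m z by [].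
rewrite in_cons => /orP[/eqP ->|/mg ->]; first by rewrite my addr0 m1y mulr1.
by rewrite gE addrC subrK.
Qed.

(** By interpolation, elements of [M] agree with [f] on any finite set of points;
    they form a filter base on [M] that converges pointwise to [f]. *)
Lemma weak_star_closed_bipolar (M : set {ptws Y -> K^o}) (f : {ptws Y -> K^o}) :
    M `<=` continuous_dual Y -> linear_subspace (M : set (Y -> K^o)) ->
    weak_star_closed M -> continuous_dual Y f ->
    (forall y, (forall m, M m -> m y = 0) -> f y = 0) ->
  M f.
Proof.
move=> MY lM /closed_subspaceP[V clV VM] Yf Mf.
suff Vf : V f by have : (V `&` continuous_dual Y) f by []; rewrite VM => -[].
pose B (ys : seq Y) : set {ptws Y -> K^o} :=
  [set m | M m /\ forall y, y \in ys -> m y = f y].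
pose F := filter_from [set: seq Y] B.
have FF : Filter F.
  apply: filter_from_filter; first by exists [::].
  move=> s t _ _; exists (s ++ t) => // m [Mm mst].
  by split; split=> // y ys; apply: mst; rewrite mem_cat ys ?orbT.
have PF : ProperFilter F.
  apply: filter_from_proper => ys _.
  have linM m : M m -> linear (m : Y -> K^o) by move=> /MY[].
  have [m Mm mf] := linear_subspace_interpolate ys lM linM Yf.1 Mf.
  by exists m.
have Ff : F --> f.
  apply/pointwise_cvgP => y A /nbhs_singleton Afy.
  by exists [:: y] => // m [_ /(_ y)] /=; rewrite inE eqxx => /(_ isT) ->.
apply: (@closed_cvg _ _ F PF id V clV _ f Ff).
exists [::] => // m [Mm _] /=.
have : (M `&` continuous_dual Y) m by split; [|exact: MY].
by rewrite -VM => -[].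
Qed.

Lemma weak_star_closed_polar S : weak_star_closed (polar S).
Proof.
apply/closed_subspaceP.
exists (\bigcap_(y in S) [set f : {ptws Y -> K^o} | `|f y : K| <= 1]).
  apply: closed_bigI => y Sy.
  have cy : continuous (fun f : {ptws Y -> K^o} => f y : K^o).
    move=> f A Af.
    exact: (iffLR (pointwise_cvgP f (nbhs_filter f)) (fun B hB => hB) y A Af).
  exact: (iffLR (continuous_closedP _) cy _ (@closed_unit_disk K)).
rewrite eqEsubset; split=> f [fS Yf]; split=> //; last first.
  by move=> y Sy; exact: fS.2.
Qed.

End weak_star.

(** * Closed linear relations on a barrelled space *)

Section linear_relations.
Context (K : numFieldType) (X Y : tvsType K) (Gamma : set (X * Y)).
Context (linGamma : linear_subspace Gamma).
Implicit Types (x : X) (y : Y) (D U : set Y).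

Definition rel_kernel : set Y := [set y | Gamma (0, y)].

(** The domain of the transposed relation between [Y'] and [X']. *)
Definition transpose_dom : set {ptws Y -> K^o} := [set f | continuous_dual Y f /\
  exists g : X -> K^o, [/\ linear g, continuous g &
    forall x y, Gamma (x, y) -> f y = g x]].

Lemma relD (a : K) x x' y y' :
  Gamma (x, y) -> Gamma (x', y') -> Gamma (a *: x + x', a *: y + y').
Proof.
by have [_ GD] := (linear_subspaceP Gamma).1 linGamma; exact: GD.
Qed.

Lemma rel0 : Gamma (0, 0).
Proof. exact: ((linear_subspaceP Gamma).1 linGamma).1. Qed.

Lemma relZ (a : K) x y : Gamma (x, y) -> Gamma (a *: x, a *: y).
Proof. by move=> Gxy; have := relD a Gxy rel0; rewrite !addr0. Qed.

Lemma relB x x' y y' :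
  Gamma (x, y) -> Gamma (x', y') -> Gamma (x - x', y - y').
Proof.
by move=> Gxy Gxy'; have := relD (-1) Gxy' Gxy; rewrite !scaleN1r ![- _ + _]addrC.
Qed.

Lemma linear_subspace_rel_kernel : linear_subspace rel_kernel.
Proof.
apply/linear_subspaceP; split=> [|a y y' Gy Gy']; first exact: rel0.
by have := relD a Gy Gy'; rewrite scaler0 addr0.
Qed.

Lemma abs_convex_rel_preimage D :
  abs_convex D -> abs_convex (rel_preimage Gamma D).
Proof.
move=> cD; split; first by exists 0; [exact: cD.1|exact: rel0].
move=> a b x x' ab [y Dy Gy] [y' Dy' Gy']; exists (a *: y + b *: y').
  exact: cD.2.
by apply: relD => //; exact: relZ.
Qed.

Lemma linear_subspace_transpose_dom :
  linear_subspace (transpose_dom : set (Y -> K^o)).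
Proof.
apply/linear_subspaceP; split.
  have lc0 (E : tvsType K) :
      linear (fun _ : E => 0 : K^o) /\ continuous (fun _ : E => 0 : K^o).
    by split=> [a u v|z]; [rewrite scaler0 addr0|exact: cvg_cst].
  by split; [exact: lc0|exists (fun _ => 0); have [] := lc0 X].
have lcD (E : tvsType K) (a : K) (f g : E -> K^o) :
    (linear f /\ continuous f) -> (linear g /\ continuous g) ->
    linear (a *: f + g) /\ continuous (a *: f + g).
  move=> [lf cf] [lg cg]; split=> [b u v|z].
    have E' w : (a *: f + g) w = a * f w + g w by [].
    by rewrite !E' lf lg /GRing.scale /=; ring.
  apply: (@cvgD K K^o); last exact: cg.
  exact: (@continuous_comp E K^o K^o f _ z (cf z) (@scaler_continuous K K^o a _)).
move=> a f f' [Yf [g [lg cg fg]]] [Yf' [g' [lg' cg' fg']]]; split.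
  exact: (lcD Y).
have [lh ch] := lcD X a g g' (conj lg cg) (conj lg' cg').
exists (a *: g + g'); split=> // x y Gxy.
have -> : (a *: f + f') y = a * f y + f' y by [].
by rewrite (fg _ _ Gxy) (fg' _ _ Gxy).
Qed.

Context (domGamma : rel_dom Gamma = [set: X]).

Lemma rel_total x : exists y, Gamma (x, y).
Proof.
have : rel_dom Gamma x by rewrite domGamma.
by move=> [y _ Gxy]; exists y.
Qed.

Lemma absorbs_rel_preimage D : absorbs D -> absorbs (rel_preimage Gamma D).
Proof.
move=> aD x; have [y Gxy] := rel_total x; have [r r0 Dr] := aD y.
by exists r => //; exists (r *: y) => //; exact: relZ.
Qed.

Lemma transpose_functional (f : Y -> K^o) : linear f ->
    (forall y, rel_kernel y -> f y = 0) ->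
  exists2 g : X -> K^o, linear g & forall x y, Gamma (x, y) -> f y = g x.
Proof.
move=> lf f0; have [s Gs] := choice rel_total.
have fs x y : Gamma (x, y) -> f y = f (s x).
  move=> Gxy; apply/eqP; rewrite -subr_eq0 -(linear_formB _ _ lf) f0 //.
  by have := relB Gxy (Gs x); rewrite subrr.
exists (f \o s) => // a u v /=.
by rewrite -(fs _ _ (relD a (Gs u) (Gs v))) lf.
Qed.

Context (barX : barrelled_space X).

(** The closure of the inverse image of an absolutely convex neighbourhood is a
    barrel. *)
Lemma nearly_open U : nbhs 0 U -> nbhs 0 (closure (rel_preimage Gamma U)).
Proof.
move=> /nbhs0_abs_convex[D [D0 cD DU]].
have : nbhs 0 (closure (rel_preimage Gamma D)).
  apply: barrelled_closure => //; first exact: abs_convex_rel_preimage.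
  exact/absorbs_rel_preimage/nbhs0_absorbs.
by apply: filterS; apply: closure_subset => x [y /DU Uy Gxy]; exists y.
Qed.

(** A form [f] bounded by [1] on the right-hand set is bounded on the fibre above
    [0], a subspace, so it vanishes there and factors through [Gamma] as [g];
    and [g] is bounded by [1] on a neighbourhood of [0], so it is continuous. *)
Lemma transpose_dom_polar U : nbhs 0 U -> transpose_dom `&` polar U =
  polar (U `|` [set y | exists2 x,
    closure (rel_preimage Gamma U) x & Gamma (x, y)]).
Proof.
move=> U0; rewrite eqEsubset; split=> f.
  move=> [[Yf [g [lg cg fg]]] [_ fU]]; split=> // y [/fU //|[x clx Gxy]].
  rewrite (fg _ _ Gxy); apply: (continuous_bounded_closure cg) clx => z.
  by move=> [u Uu Gzu]; rewrite -(fg _ _ Gzu) fU.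
move=> [Yf fS]; split; last by split=> // u Uu; apply: fS; left.
split=> //.
have cl0 : closure (rel_preimage Gamma U) 0.
  exact: nbhs_singleton (nearly_open U0).
have [|g lg fg] := transpose_functional Yf.1.
  move=> y; apply: (linear_bounded_subspace Yf.1 linear_subspace_rel_kernel).
  by move=> z Gz; apply: fS; right; exists 0.
exists g; split=> //; apply: (linear_bounded_continuous lg (nearly_open U0)).
move=> x clx; have [y Gxy] := rel_total x.
by rewrite -(fg _ _ Gxy); apply: fS; right; exists x.
Qed.

Context (R : realType) (hK : real_or_complex R K).
Context (clGamma : closed Gamma).

(** If [(0, y)] is not in the closed subspace [Gamma], a continuous form [h] on
    [X * Y] vanishes on [Gamma] but not at [(0, y)]; its restriction to [Y] is in
    [transpose_dom], with transpose minus its restriction to [X]. *)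
Lemma transpose_dom_separates y :
  (forall f, transpose_dom f -> f y = 0) -> rel_kernel y.
Proof.
move=> Ty; apply: contrapT => nGy.
have : nbhs (0, y) (~` Gamma).
  by apply: open_nbhs_nbhs; split=> //; exact: closed_openC.
move=> /(nbhsB (- (0, y))); rewrite addNr => /nbhs0_abs_convex[D [D0 cD DG]].
have nDG : ~ sum_set D Gamma (0, y).
  move=> [s Gs /(abs_convexZ cD (_ : `|-1| <= 1))]; rewrite normrN1 scaleN1r.
  move=> /(_ (lexx 1)) /DG[t nGt]; rewrite opprB addrC => /addIr ts.
  by apply: nGt; rewrite ts.
have [h [lh ch hG hD hy]] := separate_from_subspace hK D0 cD linGamma nDG.
have hyE x' y' : h (x', y') = h (x', 0) + h (0, y').
  have := lh 1 (x', 0) (0, y'); rewrite !scale1r => <-; congr h.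
  by congr pair; rewrite /= ?addr0 ?add0r.
have cX : continuous (fun x : X => h (x, 0)).
  move=> x; apply: (@continuous_comp X (X * Y)%type K^o (fun x => (x, 0)) h).
    by apply: cvg_pair; [exact: cvg_id|exact: cvg_cst].
  exact: ch.
have cY : continuous (fun y : Y => h (0, y)).
  move=> z; apply: (@continuous_comp Y (X * Y)%type K^o (fun z => (0, z)) h).
    by apply: cvg_pair; [exact: cvg_cst|exact: cvg_id].
  exact: ch.
have lX : linear (fun x : X => h (x, 0)).
  by move=> a u v; rewrite -lh; congr h; congr pair; rewrite /= scaler0 addr0.
have lY : linear (fun y : Y => h (0, y)).
  by move=> a u v; rewrite -lh; congr h; congr pair; rewrite /= scaler0 addr0.
have Th : transpose_dom (fun y : Y => h (0, y)).
  split=> //; exists (fun x => - h (x, 0)); split=> [a u v|x|x' y' Gxy].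
  - by rewrite lX opprD scalerN.
  - by apply: (@cvgN K K^o); exact: cX.
  - by apply/eqP; rewrite -addr_eq0 addrC -hyE hG.
by move: hy; rewrite (Ty _ Th) normr0 ler10.
Qed.

Context (fcY : fully_complete Y).

(** Full completeness makes [transpose_dom] weak-* closed, as its traces on polars
    of neighbourhoods are polars. *)
Lemma transpose_dom_full (f : {ptws Y -> K^o}) : continuous_dual Y f ->
  (forall y, rel_kernel y -> f y = 0) -> transpose_dom f.
Proof.
move=> Yf f0; have TY : transpose_dom `<=` continuous_dual Y by move=> ? [].
apply: (weak_star_closed_bipolar TY linear_subspace_transpose_dom) => //.
  apply: fcY.2 => //; first exact: linear_subspace_transpose_dom.
  by move=> U U0; rewrite transpose_dom_polar //; exact: weak_star_closed_polar.
by move=> y Ty; apply: f0; exact: transpose_dom_separates.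
Qed.

(** Half the closure of the inverse image of [D] lies in the inverse image of
    [D] itself. *)
Lemma rel_preimage_nbhs0 U : nbhs 0 U -> nbhs 0 (rel_preimage Gamma U).
Proof.
move=> /nbhs0_abs_convex[D [D0 cD DU]].
have two0 : (2^-1 : K) != 0 by rewrite invr_eq0 (pnatr_eq0 K 2).
apply: filterS (nbhs0Z two0 (nearly_open D0)) => _ [x clx <-].
have [y Gxy] := rel_total (2^-1 *: x).
have [[n Gn Dyn]|nDy] := pselect (sum_set D rel_kernel y).
  by exists (y - n); [exact: DU|have := relB Gxy Gn; rewrite subr0].
have [f [lf cf f0 fD fy]] :=
  separate_from_subspace hK D0 cD linear_subspace_rel_kernel nDy.
have [_ [g [lg cg fg]]] := transpose_dom_full (conj lf cf) f0.
have g1 : `|g x : K| <= 1.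
  apply: (continuous_bounded_closure cg) clx => z [d Dd Gzd].
  by rewrite -(fg _ _ Gzd) fD.
move: fy; rewrite (fg _ _ Gxy) (linear_formZ _ _ lg) normrM.
rewrite ger0_norm ?invr_ge0 // ler_pdivlMl // mulr1 => /le_trans /(_ g1).
by rewrite (ler_nat K 2 1).
Qed.

End linear_relations.

Theorem mainTheorem1 (R : realType) (K : numFieldType)
    (hK : real_or_complex R K)
    (X Y : tvsType K)
    (hausX : hausdorff_space X) (barX : barrelled_space X)
    (fcY : fully_complete Y)
    (Gamma : set (X * Y))
    (linGamma : linear_subspace Gamma) (clGamma : closed Gamma)
    (domGamma : rel_dom Gamma = [set: X])
    (B : set Y) (oB : open B) :
  open (rel_preimage Gamma B).
Proof.
rewrite openE => x [b Bb Gxb].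
have : nbhs 0 [set y | B (b + y)].
  have /(nbhsB (- b)) : nbhs b B by exact: open_nbhs_nbhs.
  by rewrite addNr; apply: filterS => _ [y By <-] /=; rewrite addrA subrr add0r.
move=> /(rel_preimage_nbhs0 linGamma domGamma barX hK clGamma fcY) /(nbhsT x).
apply: filterS => _ [z [y By Gzy] <-]; exists (b + y) => //.
by have := relD linGamma 1 Gxb Gzy; rewrite !scale1r.
Qed.
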